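(* Let $g\ge0$, $d\ge1$, $k\ge0$, $n\ge1$ be integers and let $\Delta_1,\dots,\Delta_n\vdash d$. Then for every $i\in\{1,\dots,n\}$, $$\frac{\partial\,\Phi_g\{z|(u_1,\Delta_1),\dots,(u_n,\Delta_n)|p^{(1)},\dots,p^{(k)},p\}}{\partial u_i}=W(\Delta_i,z)\,\Phi_g\{z|(u_1,\Delta_1),\dots,(u_n,\Delta_n)|p^{(1)},\dots,p^{(k)},p\},$$ where $W(\Delta_i,z)$ acts in the variables $p=(p_1,p_2,\dots)$.
   Context: For a partition $\Delta=(\delta_1,\dots,\delta_n)\vdash d$: $l(\Delta)=n$; $m_r(\Delta)=\#\{i:\delta_i=r\}$; $\Delta!=\prod_{r\ge1}m_r(\Delta)!$; $p_\Delta=p_{\delta_1}\cdots p_{\delta_n}$ (similarly $p^{(i)}_\Delta$ for another family of time-variables $p^{(i)}=(p^{(i)}_1,p^{(i)}_2,\dots)$); $\frac{\partial}{\partial p_\Delta}=\frac{1}{\Delta!}\frac{\partial}{\partial p_{\delta_1}}\cdots\frac{\partial}{\partial p_{\delta_n}}$. $|C_\Delta|$ is the number of permutations in $S_d$ of cycle type $\Delta$. For $\lambda\vdash d$, $\dim\lambda$ and $\chi_\lambda(\Delta)$ denote the dimension of the irreducible representation of $S_d$ indexed by $\lambda$ and its character value on permutations of cycle type $\Delta$, and $\phi_\lambda(\Delta)=\frac{1}{\dim\lambda}|C_\Delta|\chi_\lambda(\Delta)$. Generalized Hurwitz numbers: for $g\ge0$ and $\Delta_1,\dots,\Delta_k\vdash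 d$, $\mu_g^{h,d}(\Delta_1,\dots,\Delta_k)$ is the number of equivalence classes (weighted by inverse order of automorphism group) of degree $d$ ramified coverings of a connected compact Riemann surface of genus $g$, by possibly disconnected Riemann surfaces of genus $h$, with ramification types $\Delta_1,\dots,\Delta_k$ over $k$ fixed points. It is given by $$\mu_g^{h,d}(\Delta_1,\dots,\Delta_k)=\sum_{\lambda\vdash d}\Big(\frac{\dim\lambda}{d!}\Big)^{2-2g}\phi_\lambda(\Delta_1)\cdots\phi_\lambda(\Delta_k),$$ where $h$ is determined by the Hurwitz formula $(2-2g)d-(2-2h)=\sum_{i=1}^k(d-l(\Delta_i))$. Genus expanded cut-and-join operator of $\Delta\vdash d$ ($z$ an indeterminate): $$W(\Delta,z)=\sum_{\Gamma,\Gamma'\vdash d}\frac{d!}{|C_{\Gamma'}|}\,z^{\,d+l(\Gamma')-l(\Delta)-l(\Gamma)}\,\mu_0^{h_+,d}(\Gamma',\Delta,\Gamma)\,p_\Gamma\frac{\partial}{\partial p_{\Gamma'}},$$ with $h_+$ determined by $2d-(2-2h_+)=(d-l(\Gamma'))+(d-l(\Delta))+(d-l(\Gamma))$. Generating function, a formal power series in the indeterminates $u_1,\dots,u_n$: $$\Phi_g\{z|(u_1,\Delta_1),\dots,(u_n,\Delta_n)|p^{(1)},\dots,p^{(k)},p\}=\sum_{l_1,\dots,l_n\ge0}\ \sum_{\Gamma,\Gamma_1,\dots,\Gamma_k\vdash d}z^{2h-2}\,\mu_g^{h,d}(\underbrace{\Delta_1,\dots,\Delta_1}_{l_1},\dots,\underbrace{\Delta_n,\dots,\Delta_n}_{l_n},\Gamma_1,\dots,\Gamma_k,\Gamma)\Big[\prod_{j=1}^n\frac{u_j^{l_j}}{l_j!}\Big]\Big[\prod_{i=1}^kp^{(i)}_{\Gamma_i}\Big]p_\Gamma,$$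 where $2h-2$ is determined in each term by $$(2-2g)d-(2-2h)=\sum_{j=1}^nl_j(d-l(\Delta_j))+\sum_{j=1}^k(d-l(\Gamma_j))+(d-l(\Gamma)).$$ *)

(* Defs.v *)
From HB Require Import structures.
From mathcomp Require Import all_boot all_order all_algebra.
From mathcomp Require Import all_fingroup all_solvable all_field all_character.
From mathcomp Require Import fraction.
From mathcomp Require Import finmap.
From mathcomp Require Export monalg.

Set Implicit Arguments.
Unset Strict Implicit.
Unset Printing Implicit Defensive.

Import GRing.Theory.

Local Open Scope ring_scope.

Definition is_part (d : nat) (s : seq nat) : bool :=
  [&& sorted geq s, all (leq 1) s & sumn s == d].

Record intpart (d : nat) : predArgType :=
  IntPart { parts :> seq nat; _ : is_part d parts }.

HB.instance Definition _ d := [isSub for @parts d].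
HB.instance Definition _ d := [Countable of intpart d by <:].

Section IntpartFinite.
Variable d : nat.

Let bseq_of_part (D : intpart d) : {bseq d of 'I_d.+1} :=
  insub_bseq d (map inord D).
Let part_of_bseq (b : {bseq d of 'I_d.+1}) : option (intpart d) :=
  insub (map val b).

Fact bseq_of_partK : pcancel bseq_of_part part_of_bseq.
Proof.
move=> D; rewrite /part_of_bseq /bseq_of_part.
have /and3P[_ pos /eqP sumD] := valP D.
have sizeD : (size (map (inord : nat -> 'I_d.+1) D) <= d)%N.
  rewrite size_map; have ->: size D = (\sum_(x <- D) 1)%N by rewrite sum1_size.
  rewrite -[leqRHS]sumD sumnE !big_seq; apply: leq_sum => x.
  exact: (allP pos).
rewrite /insub_bseq val_insubd sizeD -map_comp map_id_in ?valK // => x xD /=.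
by rewrite inordK // ltnS -[leqRHS]sumD sumnE (big_rem x xD) leq_addr.
Qed.

HB.instance Definition _ : isFinite (intpart d) := PCanIsFinite bseq_of_partK.
End IntpartFinite.

(* l(D) *)
Definition len d (D : intpart d) : nat := size D.

(* D! = prod_r m_r(D)!; parts are at most d, so r < d.+1 suffices. *)
Definition autfact d (D : intpart d) : nat :=
  (\prod_(1 <= r < d.+1) (count_mem r D)`!)%N.

Definition cycle_type d (s : 'S_d) : seq nat :=
  sort geq [seq #|C| | C : {set 'I_d} in porbits s].

Definition cyc_class d (D : intpart d) : {set 'S_d} :=
  [set s | cycle_type s == D].

(* The irreducible representations of S_d are enumerated by MathComp's Iirr,  *)
(* so that "lam" ranges over each isomorphism class exactly once; dim lam is  *)
(* the value at 1, chi_lam(D) the value at any permutation of cycle type D.   *)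
Definition SIirr (d : nat) : finType := Iirr [set: 'S_d]%G.

Definition dimS d (lam : SIirr d) : algC := 'chi[[set: 'S_d]%G]_lam 1%g.

Definition chiS d (lam : SIirr d) (D : intpart d) : algC :=
  'chi[[set: 'S_d]%G]_lam (repr (cyc_class D)).

Definition phiS d (lam : SIirr d) (D : intpart d) : algC :=
  (dimS lam)^-1 * #|cyc_class D|%:R * chiS lam D.

(* mu_g^{h,d}(D_1, ..., D_k), by the Frobenius-Mednykh character formula; the *)
(* genus h does not enter the formula, see [cover_2h2].                       *)
Definition mu (g d : nat) (Ds : seq (intpart d)) : algC :=
  \sum_(lam : SIirr d)
     (dimS lam / d`!%:R) ^ (2 - 2 * g%:Z) * \prod_(D <- Ds) phiS lam D.

(* The integer 2h-2 determined by (2-2g)d - (2-2h) = sum_i (d - l(D_i)).  It  *)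
(* can be odd, or smaller than any genuine covering allows; mu is then 0.     *)
Definition cover_2h2 (g d : nat) (Ds : seq (intpart d)) : int :=
  \sum_(D <- Ds) (d%:Z - (len D)%:Z) - (2 - 2 * g%:Z) * d%:Z.

(* algC(z): exponents of z may be negative. *)
Definition zfield : fieldType := {fraction {poly algC}}.

Definition zvar : zfield := tofrac 'X.

Definition zconst (c : algC) : zfield := tofrac c%:P.

(* Polynomials over a field in infinitely many variables: (None, r) is p_r    *)
(* and (Some i, r) is p^(i)_r.  No variable with r = 0 is ever used.          *)
Definition tvar (k : nat) : choiceType := (option 'I_k * nat)%type.

Definition tpoly (k : nat) := {malg zfield[{cmonom (tvar k)}]}.

Section TimeVariables.
Variable k : nat.

Definition pvar (v : tvar k) : tpoly k := << ucm v >>.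

Definition pderiv (v : tvar k) (f : tpoly k) : tpoly k :=
  \sum_(m <- msupp f) << f@_m *+ m v *g divcm m (ucm v) >>.

Variable d : nat.

(* p_D (for a = None) or p^(i)_D (for a = Some i) *)
Definition pmonom (a : option 'I_k) (D : intpart d) : tpoly k :=
  \prod_(r <- D) pvar (a, r).

(* d/dp_D *)
Definition dpart (D : intpart d) (f : tpoly k) : tpoly k :=
  (autfact D)%:R^-1 *: foldr (fun r => pderiv (None, r)) f D.

(* The genus expanded cut-and-join operator W(D, z), acting in the variables p *)
Definition W (D : intpart d) (f : tpoly k) : tpoly k :=
  \sum_(G : intpart d) \sum_(G' : intpart d)
    (zconst (d`!%:R / #|cyc_class G'|%:R * mu 0 [:: G'; D; G])
     * zvar ^ (d%:Z + (len G')%:Z - (len D)%:Z - (len G)%:Z))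
    *: (pmonom None G * dpart G' f).

End TimeVariables.

(* A series is the family of its coefficients: F l is that of u^l. *)
Definition fps (n : nat) (A : Type) := 'X_{1..n} -> A.

(* d/du_i : the coefficient of u^l is (l_i + 1) times that of u^(l + e_i). *)
Definition fps_deriv (n : nat) (A : nmodType) (i : 'I_n) (F : fps n A)
  : fps n A := fun l => F (mulcm l (ucm i)) *+ (l i).+1.

(* An operator on the coefficients, extended to series. *)
Definition fps_map (n : nat) (A B : Type) (f : A -> B) (F : fps n A)
  : fps n B := fun l => f (F l).

(* The profiles D_1 (l_1 times), ..., D_n (l_n times), G_1, ..., G_k, G. *)
Definition profiles d k n (D : 'I_n -> intpart d) (l : 'X_{1..n})
    (Gs : k.-tuple (intpart d)) (G : intpart d) : seq (intpart d) :=
  flatten [seq nseq (l j) (D j) | j <- enum 'I_n] ++ Gs ++ [:: G].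

(* The generating function Phi_g *)
Definition Phi (g d k n : nat) (D : 'I_n -> intpart d) : fps n (tpoly k) :=
  fun l =>
    \sum_(G : intpart d) \sum_(Gs : k.-tuple (intpart d))
      (zvar ^ cover_2h2 g (profiles D l Gs G)
       * zconst (mu g (profiles D l Gs G) * \prod_(j < n) ((l j)`!%:R)^-1))
      *: ((\prod_(i < k) pmonom (Some i) (tnth Gs i)) * pmonom None G).

(* Main.v *)
From HB Require Import structures.
Require Import Defs.
From mathcomp Require Import all_boot all_order all_algebra.
From mathcomp Require Import all_fingroup all_field all_character.
From mathcomp Require Import fraction finmap ring.

(** The coefficient of u^l p_Gamma in Phi_g is a character sum over lambda of
    a weight depending on l times phi_lambda(Gamma).  Row orthogonality,
    sum_Gamma' (d!/|C_Gamma'|) phi_nu(Gamma') phi_lambda(Gamma')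
      = delta_{nu,lambda} (d!/dim lambda)^2,
    shows that gluing a sphere mu_0(Gamma', Delta_i, Gamma) along Gamma'
    inserts one more factor phi_lambda(Delta_i).  Since d/dp_Gamma' is dual to
    p_Gamma on partitions of d, this gluing is the action of W(Delta_i, z), and
    the powers of z match because Euler characteristics add. *)

Set Implicit Arguments.
Unset Strict Implicit.
Unset Printing Implicit Defensive.

Import GRing.Theory Num.Theory.

(** * Conjugacy of permutations with equal cycle lengths *)

Lemma perm_eq_map_exists (A B : eqType) (R : eqType) (f : A -> R) (g : B -> R)
    (b0 : B) (r1 : seq A) (r2 : seq B) :
    uniq r1 -> uniq r2 -> perm_eq (map f r1) (map g r2) ->
  exists2 h : A -> B, {in r1 &, injective h} &
    forall a, a \in r1 -> h a \in r2 /\ g (h a) = f a.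
Proof.
elim: r1 r2 => [|a r1 IHr1] r2 /=.
  by move=> _ _ _; exists (fun=> b0).
case/andP=> ar1 Ur1 Ur2 p12.
have /mapP[b br2 fab]: f a \in map g r2 by rewrite -(perm_mem p12) mem_head.
have p12': perm_eq (map f r1) (map g (rem b r2)).
  rewrite -(perm_cons (f a)) (perm_trans p12) // fab -/(map g (b :: rem b r2)).
  by rewrite perm_map // perm_to_rem.
have [h hinj hP] := IHr1 _ Ur1 (rem_uniq b Ur2) p12'.
have hb c : c \in r1 -> h c != b.
  by move/hP=> []; rewrite mem_rem_uniq // => /andP[].
have ca c : c \in r1 -> (c == a) = false.
  by move=> cr1; apply: contraNF ar1 => /eqP <-.
(* The inductive [h] takes values in [rem b r2], hence avoids [b] by uniqueness, so sending [a] to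
   [b] keeps injectivity. *)
exists (fun c => if c == a then b else h c) => [c c'|c].
  rewrite !inE => /predU1P[->|cr1] /predU1P[->|c'r1] //; rewrite ?eqxx ?ca //.
  - by move/esym/eqP; rewrite (negPf (hb _ _)).
  - by move/eqP; rewrite (negPf (hb _ _)).
  exact: hinj.
rewrite inE; have [->|_ /=] := eqVneq c a; first by rewrite fab.
by move/hP=> []; rewrite mem_rem_uniq // => /andP[].
Qed.

Section Conjugacy.
Variable T : finType.
Implicit Types (s t : {perm T}) (x y : T).

Lemma porbit_expgE s x k :
  (s ^+ k)%g x = nth x (traject s x #|porbit s x|) (k %% #|porbit s x|).
Proof.
have n0: 0 < #|porbit s x| by rewrite lt0n card_porbit_neq0.
rewrite nth_traject ?ltn_mod // {1}(divn_eq k #|porbit s x|) addnC permX iterD.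
congr (iter _ _ _); elim: (k %/ _) => // q IHq.
by rewrite mulSn iterD IHq iter_porbit.
Qed.

Lemma porbit_expg_eq s x k l :
  ((s ^+ k)%g x == (s ^+ l)%g x) = (k == l %[mod #|porbit s x|]).
Proof.
have n0: 0 < #|porbit s x| by rewrite lt0n card_porbit_neq0.
by rewrite !porbit_expgE nth_uniq ?size_traject ?ltn_mod ?uniq_traject_porbit.
Qed.

Lemma perm_eq_porbits_conj s t :
    perm_eq [seq #|C| | C : {set T} in porbits s]
            [seq #|C| | C : {set T} in porbits t] ->
  exists u, t = (s ^ u)%g.
Proof.
move=> /(perm_eq_map_exists set0 (enum_uniq _) (enum_uniq _))[h hinj hP].
have Cs x : porbit s x \in enum (porbits s) by rewrite mem_enum imset_f.
(* The default [x] is never reached, since cycles are nonempty; hence the base point depends on the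
   cycle alone. The same holds for [b] below. *)
pose a C x : T := odflt x [pick y in C : {set T}].
have aP x : a (porbit s x) x \in porbit s x.
  by rewrite /a; case: pickP => //= /(_ x); rewrite porbit_id.
have aE x y : porbit s x = porbit s y -> a (porbit s x) x = a (porbit s y) y.
  move=> ->; rewrite /a; case: pickP => //= /(_ y).
  by rewrite porbit_id.
pose b x : T := odflt x [pick y in h (porbit s x)].
have hb x : h (porbit s x) = porbit t (b x).
  have [] := hP _ (Cs x); rewrite mem_enum => /imsetP[y _ hy] _.
  rewrite /b hy; case: pickP => /= [z|/(_ y)]; last by rewrite porbit_id.
  by rewrite -eq_porbit_mem => /eqP.
have bE x y : porbit s x = porbit s y -> b x = b y.
  move=> sxy; rewrite /b sxy; case: pickP => //= /(_ (b y)).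
  by rewrite hb porbit_id.
have kP x : exists k, x == (s ^+ k)%g (a (porbit s x) x).
  have /porbitP[k xk] : x \in porbit s (a (porbit s x) x).
    by rewrite porbit_sym aP.
  by exists k; rewrite -xk.
(* [h] matches the cycles of [s] with those of [t]; [a] and [b] are base points
   of matched cycles, and the conjugator sends [s^k a] to [t^k b]. *)
pose f x := (t ^+ xchoose (kP x))%g (b x).
(* Both equalities say that [k] and [l] agree modulo the common length of the matched cycles. This
   one equivalence yields that the image is independent of the chosen exponent, and that [f] is
   injective. *)
have fE x y k l : porbit s x = porbit s y ->
    x = (s ^+ k)%g (a (porbit s x) x) -> y = (s ^+ l)%g (a (porbit s y) y) ->
  ((t ^+ k)%g (b x) == (t ^+ l)%g (b y)) = (x == y).
  move=> sxy xE yE; rewrite {2}xE {2}yE -(aE _ _ sxy) -(bE _ _ sxy).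
  rewrite !porbit_expg_eq -hb (hP _ (Cs x)).2.
  have /eqP-> // : porbit s (a (porbit s x) x) == porbit s x.
  by rewrite eq_porbit_mem.
have tf x : t (f x) = f (s x).
  have sxx : porbit s (s x) = porbit s x by rewrite (porbit_perm s 1).
  have /eqP xE := xchooseP (kP x); have /eqP sxE := xchooseP (kP (s x)).
  (* The exponent chosen for [s x] need not be one more than that for [x]; [fE] reconciles the
     two. *)
  have sxE' : s x = (s ^+ (xchoose (kP x)).+1)%g (a (porbit s (s x)) (s x)).
    by rewrite expgSr permM -(aE x) // -xE.
  apply/eqP; rewrite /f -permM -expgSr -(bE (s x) x sxx).
  by rewrite (fE (s x) (s x) _ _ erefl sxE' sxE).
have finj : injective f.
  move=> x y fxy; have /eqP xE := xchooseP (kP x).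
  have /eqP yE := xchooseP (kP y).
  have sxy : porbit s x = porbit s y.
    apply: hinj => //; rewrite !hb -(porbit_perm t (xchoose (kP x)) (b x)).
    by rewrite -(porbit_perm t (xchoose (kP y)) (b y)) -/(f x) fxy.
  by apply/eqP; rewrite -(fE x y _ _ sxy xE yE); apply/eqP.
exists (perm finj); apply/permP=> x.
by rewrite -{1 2}(permKV (perm finj) x) permJ !permE tf.
Qed.

End Conjugacy.

(** * Row orthogonality of the characters of S_d, summed over partitions *)

Section CharacterOrthogonality.
Variable d : nat.
Implicit Types (D : intpart d) (s t : 'S_d) (lam nu : SIirr d).
Local Open Scope ring_scope.

Lemma cycle_type_is_part s : is_part d (cycle_type s).
Proof.
apply/and3P; split.
- by apply: sort_sorted => m n; apply: leq_total.
- apply/allP=> m; rewrite mem_sort => /mapP[C].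
  rewrite mem_enum => /imsetP[x _ ->] ->.
  by rewrite lt0n card_porbit_neq0.
rewrite (perm_sumn (permEl (perm_sort _ _))) sumnE big_map big_enum /=.
rewrite -[X in _ == X]card_ord -cardsT.
have -> : [set: 'I_d] = cover (porbits s).
  apply/setP=> x; rewrite inE; apply/esym/bigcupP.
  by exists (porbit s x); rewrite ?porbit_id ?imset_f.
(* By definition, [trivIset] is the equality between the sum of the cardinals and the cardinal of
   the cover. *)
suff: trivIset (porbits s) by [].
apply/trivIsetP=> _ _ /imsetP[x _ ->] /imsetP[y _ ->].
apply: contraR => /pred0Pn[z /andP[/=]].
by rewrite -!eq_porbit_mem => /eqP<-.
Qed.

(** Characters are class functions and a cycle type is a single conjugacy class, so the
    representative used in [chiS] is immaterial. *)
Lemma chi_cyc_class lam D s : s \in cyc_class D ->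
  'chi[[set: 'S_d]%G]_lam s = chiS lam D.
Proof.
move=> sD; have := mem_repr _ sD; rewrite /chiS.
move: sD (repr _) => + t; rewrite !inE => /eqP sD /eqP tD.
have [|u ->] := @perm_eq_porbits_conj _ s t; last by rewrite cfunJ ?inE.
by rewrite -(perm_sort geq) perm_sym -(perm_sort geq) -/(cycle_type t) tD -sD.
Qed.

Lemma cycle_typeV s : cycle_type s^-1%g = cycle_type s.
Proof. by rewrite /cycle_type porbitsV. Qed.

(** Inversion preserves cycle type. This removes the inverse from the first orthogonality
    relation. *)
Lemma chiV lam s : 'chi[[set: 'S_d]%G]_lam s^-1%g = 'chi_lam s.
Proof.
pose D := IntPart (cycle_type_is_part s).
by rewrite !(@chi_cyc_class _ D) // inE ?cycle_typeV.
Qed.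

Lemma chiS_orthogonality lam nu :
  \sum_D #|cyc_class D|%:R * chiS lam D * chiS nu D = d`!%:R * (lam == nu)%:R.
Proof.
rewrite -(first_orthogonality_relation lam nu) cardsT card_Sn.
rewrite mulVKf ?pnatr_eq0 -?lt0n ?fact_gt0 //.
rewrite (partition_big (fun s => IntPart (cycle_type_is_part s)) predT) //=.
apply: eq_bigr => D _; rewrite -mulrA mulr_natl -sumr_const.
apply: eq_big => [s|s sD]; first by rewrite !inE.
by rewrite chiV !(chi_cyc_class _ sD).
Qed.

Lemma dimS_neq0 lam : dimS lam != 0.
Proof. exact: irr1_neq0. Qed.

Lemma phiS_orthogonality lam nu :
  \sum_D d`!%:R / #|cyc_class D|%:R * (phiS lam D * phiS nu D)
    = (d`!%:R / dimS lam) ^+ 2 * (lam == nu)%:R.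
Proof.
have -> : \sum_D d`!%:R / #|cyc_class D|%:R * (phiS lam D * phiS nu D)
  = d`!%:R / (dimS lam * dimS nu)
      * \sum_D #|cyc_class D|%:R * chiS lam D * chiS nu D.
  rewrite mulr_sumr; apply: eq_bigr => D _; rewrite /phiS invfM.
  (* For an empty class both summands are 0, so afterwards the cardinal can be cancelled. *)
  have [->|C0] := eqVneq #|cyc_class D| 0%N; first by rewrite !(mulr0, mul0r).
  have : #|cyc_class D|%:R != 0 :> algC by rewrite pnatr_eq0.
  by move=> Cn0; field; rewrite !dimS_neq0.
rewrite chiS_orthogonality; have [<-|_] := eqVneq; last by rewrite !mulr0.
by rewrite !mulr1; field; rewrite dimS_neq0.
Qed.

End CharacterOrthogonality.

(** * Iterated partial derivatives of monomials *)

Lemma monalgUZ (K : choiceType) (R : nzRingType) (a c : R) (x : K) :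
  (<< a * c *g x >> = a *: << c *g x >>)%R.
Proof. by apply/malgP=> y; rewrite mcoeffZ !mcoeffU mulrnAr. Qed.

Section Derivation.
Variable k : nat.
Local Open Scope ring_scope.
Implicit Types (v : tvar k) (f : tpoly k) (m : {cmonom (tvar k)}).

(** A summation range independent of [f] allows the derivatives of several polynomials to be
    compared term by term, as linearity requires. *)
Lemma pderivEw (S : {fset {cmonom (tvar k)}}) v f : (msupp f `<=` S)%fset ->
  pderiv v f = \sum_(m <- S) << f@_m *+ m v *g divcm m (ucm v) >>.
Proof.
move=> fS; rewrite /pderiv (big_fset_incl _ fS) //= => m _ /mcoeff_outdom->.
by rewrite mul0rn monalgU0.
Qed.

Fact pderiv_is_linear v : linear (pderiv v).
Proof.
move=> a f h; pose S := (msupp f `|` msupp h `|` msupp (a *: f + h))%fset.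
rewrite (@pderivEw S _ f) ?(@pderivEw S _ h) ?(@pderivEw S _ (_ + _)) ?fsubsetUr //.
- rewrite scaler_sumr -big_split; apply: eq_bigr => m _ /=.
  by rewrite mcoeffD mcoeffZ mulrnDl monalgUD -mulrnAr monalgUZ.
- by rewrite /S fsubsetU // fsubsetUr.
by rewrite /S fsubsetU // fsubsetUl.
Qed.

HB.instance Definition _ v :=
  GRing.isLinear.Build zfield (tpoly k) (tpoly k) _
    (pderiv v) (pderiv_is_linear v).

Lemma pderivU v c m :
  pderiv v << c *g m >> = << c *+ m v *g divcm m (ucm v) >> :> tpoly k.
Proof.
by rewrite (pderivEw v msuppU_le) big_seq_fset1 mcoeffUU.
Qed.

Lemma foldr_divcmE (s : seq nat) m b r :
  foldr (fun r m' => divcm m' (ucm (None, r))) m s (b, r)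
    = (m (b, r) - (b == None) * count_mem r s)%N.
Proof.
elim: s => [|q s IHs] /=; first by rewrite muln0 subn0.
by rewrite divcmE IHs cmU xpair_eqE eq_sym -subnDA mulnDr mulnb addnC.
Qed.

Lemma foldr_pderivU (N : nat) (s : seq nat) c m :
    {in s, forall r, (0 < r < N)%N} ->
  foldr (fun r => pderiv (None, r)) << c *g m >> s =
  << c *+ \prod_(1 <= r < N) (m (None, r)) ^_ (count_mem r s)
      *g foldr (fun r m' => divcm m' (ucm (None, r))) m s >> :> tpoly k.
Proof.
elim: s => [|r s IHs] sN /=.
  by rewrite big1_seq // => r _; rewrite ffactn0.
rewrite {}IHs => [|q qs]; last by apply: sN; rewrite inE qs orbT.
rewrite pderivU -mulrnA; congr << _ *+ _ *g _ >>.
have /andP[r0 rN]: (0 < r < N)%N by apply: sN; rewrite mem_head.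
have rI : r \in index_iota 1 N by rewrite mem_index_iota r0.
(* The tail of [s] is differentiated first, so the exponent of p_r has already dropped by its
   multiplicity there: this is the last factor of the next falling factorial. *)
rewrite foldr_divcmE /= mul1n !(bigD1_seq r rI (iota_uniq _ _)) /= eqxx ffactnSr.
rewrite -!mulnA; congr muln; rewrite mulnC; congr muln.
by apply: eq_bigr => q; rewrite eq_sym => /negPf->.
Qed.

End Derivation.

(** * Duality between the derivatives by p_D and the monomials p_E *)

Lemma prod_monalgU (K : conomType) (R : comNzRingType) (I : Type) (r : seq I)
    (F : I -> K) :
  (\prod_(i <- r) (<< F i >> : {malg R[K]}) = << \big[mmul/mone]_(i <- r) F i >>)%R.
Proof.
elim: r => [|i r IHr]; first by rewrite !big_nil.
by rewrite !big_cons IHr malgM_def fgmulUU mulr1.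
Qed.

Lemma intpart_mem d (D : intpart d) r : r \in (D : seq nat) -> 0 < r < d.+1.
Proof.
move=> rD; have /and3P[_ /allP/(_ _ rD) r0 /eqP sumD] := valP D.
by rewrite r0 ltnS -[leqRHS]sumD (perm_sumn (perm_to_rem rD)) leq_addr.
Qed.

(** The parts of [E] left over after removing those of [D] sum to d - d = 0 and are positive, so
    there are none. *)
Lemma intpart_count_inj d (D E : intpart d) :
  (forall r, 0 < r < d.+1 -> count_mem r D <= count_mem r E) -> D = E.
Proof.
move=> leDE; have /and3P[Dsorted _ /eqP sumD] := valP D.
have /and3P[Esorted Epos /eqP sumE] := valP E.
apply/val_inj/(@sorted_eq _ geq) => //.
- by move=> b a c ab bc; apply: leq_trans bc ab.
- by move=> a b; rewrite andbC => /anti_leq.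
have /count_subseqP[s sE Ds]: forall r, count_mem r D <= count_mem r E.
  move=> r; have [/leDE //|rd] := boolP (0 < r < d.+1).
  by rewrite (count_memPn _) //; apply: contra rd => /intpart_mem.
have [t Est] := perm_to_subseq sE.
have : sumn t = 0.
  apply/eqP; rewrite -(eqn_add2l (sumn s)) -sumn_cat -(perm_sumn Est) addn0.
  by rewrite -(perm_sumn Ds) [X in X == _]sumE sumD.
have : all (leq 1) t by move: Epos; rewrite (perm_all _ Est) all_cat => /andP[].
case: t Est => [|[|x] t] //; rewrite cats0 => Es _ _.
by rewrite (perm_trans Ds) // perm_sym.
Qed.

Lemma scaler_linear (R : comNzRingType) (V : lmodType R) (a c : R) (u v : V) :
  (a *: (c *: u + v) = c *: (a *: u) + a *: v)%R.
Proof. by rewrite scalerDr !scalerA mulrC. Qed.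

Section PartitionDerivation.
Variables (k d : nat).
Local Open Scope ring_scope.
Implicit Types (a : option 'I_k) (D E : intpart d) (m : {cmonom (tvar k)}).

Definition cmonom_seq a (s : seq nat) : {cmonom (tvar k)} :=
  \big[mmul/mone]_(r <- s) ucm (a, r).

Lemma cmonom_seqE a s b r : cmonom_seq a s (b, r) = ((a == b) * count_mem r s)%N.
Proof.
rewrite /cmonom_seq; elim: s => [|q s IHs]; first by rewrite big_nil cm1 muln0.
by rewrite big_cons cmM IHs cmU xpair_eqE /= mulnDr mulnb.
Qed.

Lemma pmonomE a D : pmonom a D = << cmonom_seq a D >> :> tpoly k.
Proof. exact: prod_monalgU. Qed.

Lemma natr_zfield_neq0 n : (0 < n)%N -> n%:R != 0 :> zfield.
Proof.
move=> n0; have -> : n%:R = tofrac (n%:R)%:P :> zfield.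
  by rewrite polyC_natr rmorph_nat.
by rewrite tofrac_eq0 polyC_eq0 pnatr_eq0 -lt0n.
Qed.

Fact dpart_is_linear D : linear (@dpart k d D).
Proof.
move=> c f h; rewrite /dpart.
have -> : foldr (fun r => pderiv (None, r)) (c *: f + h) D
  = c *: foldr (fun r => pderiv (None, r)) f D
    + foldr (fun r => pderiv (None, r)) h D.
  by elim: (D : seq nat) => //= r s ->; rewrite linearP.
exact: scaler_linear.
Qed.

HB.instance Definition _ D :=
  GRing.isLinear.Build zfield (tpoly k) (tpoly k) _
    (@dpart k d D) (dpart_is_linear D).

(** Differentiation produces the product over r of the falling factorials of m_r(E) of length
    m_r(D). For D = E this is D!, which the normalization cancels; otherwise some m_r(D) exceeds
    m_r(E) and that factor is 0. The monomial [m], free of the variables p, behaves as a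
    constant. *)
Lemma dpart_pmonom D E m : (forall r, m (None, r) = 0%N) ->
  dpart D (<< m >> * pmonom None E) = << m >> *+ (D == E) :> tpoly k.
Proof.
move=> m0; rewrite pmonomE malgM_def fgmulUU mulr1 /dpart.
rewrite (@foldr_pderivU _ d.+1); last by move=> r; apply: intpart_mem.
under eq_bigr => r _ do rewrite cmM m0 cmonom_seqE eqxx mul1n add0n.
have [->|neqDE] := eqVneq D E.
  under eq_bigr => r _ do rewrite ffactnn.
  rewrite -/(autfact E) -monalgUZ mulVf; last first.
    by rewrite natr_zfield_neq0 // prodn_gt0 // => r; apply: fact_gt0.
  rewrite mulr1n; set m' := foldr _ _ _; have -> // : m' = m.
  apply/eqP/cmP => -[b r].
  by rewrite foldr_divcmE cmM cmonom_seqE [None == b]eq_sym addnK.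
suff -> : (\prod_(1 <= r < d.+1) (count_mem r E) ^_ (count_mem r D) = 0)%N.
  by rewrite monalgU0 scaler0.
apply/eqP; apply: contraNT neqDE => prod_neq0; apply/eqP/intpart_count_inj => r rd.
rewrite leqNgt; apply: contraNN prod_neq0 => ltED.
rewrite (bigD1_seq r) ?iota_uniq ?mem_index_iota //=.
by rewrite ffact_small.
Qed.

End PartitionDerivation.

(** * Inserting one more ramification profile *)

Section Profiles.
Variables (d k n : nat) (Delta : 'I_n -> intpart d).
Implicit Types (l : 'X_{1..n}) (Gs : k.-tuple (intpart d)) (G : intpart d).
Local Open Scope ring_scope.

(** Stated for any commutative monoid to serve both the product of the [phiS] in [mu] and the sum in
    [cover_2h2]. *)
Lemma big_profiles (R : Type) (idx : R) (op : Monoid.com_law idx)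
    (F : intpart d -> R) l Gs G :
  \big[op/idx]_(D <- profiles Delta l Gs G) F D
    = op (op (\big[op/idx]_(j < n) iterop (l j) op (F (Delta j)) idx)
             (\big[op/idx]_(D <- Gs) F D)) (F G).
Proof.
rewrite /profiles !big_cat big_seq1 big_flatten big_map big_enum /=.
rewrite Monoid.mulmA; congr (op (op _ _) _); apply: eq_bigr => j _.
by rewrite big_nseq Monoid.iteropE.
Qed.

Lemma big_profilesM (R : Type) (idx : R) (op : Monoid.com_law idx)
    (F : intpart d -> R) l i Gs G :
  \big[op/idx]_(D <- profiles Delta (mulcm l (ucm i)) Gs G) F D
    = op (F (Delta i)) (\big[op/idx]_(D <- profiles Delta l Gs G) F D).
Proof.
rewrite !big_profiles !Monoid.mulmA; congr (op (op _ _) _).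
rewrite (bigD1 i) //= [in RHS](bigD1 i) //= cmM cmU eqxx addn1.
rewrite !Monoid.iteropE iterS -Monoid.mulmA; congr (op _ (op _ _)).
by apply: eq_bigr => j /negPf ji; rewrite cmM cmU eq_sym ji addn0.
Qed.

(** The exponent of z in [W] is (d - l(Delta_i)) + (d - l(G)) - (d - l(G')), and its last term
    cancels the contribution of the glued profile [G']. *)
Lemma cover_2h2_profilesM (g : nat) l i Gs G G' :
  cover_2h2 g (profiles Delta (mulcm l (ucm i)) Gs G)
    = (d%:Z + (len G')%:Z - (len (Delta i))%:Z - (len G)%:Z)
      + cover_2h2 g (profiles Delta l Gs G').
Proof. by rewrite /cover_2h2 big_profilesM !big_profiles /=; ring. Qed.

Lemma mu0_seq3 (D1 D2 D3 : intpart d) :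
  mu 0 [:: D1; D2; D3] = \sum_(lam : SIirr d)
    (dimS lam / d`!%:R) ^+ 2 * (phiS lam D1 * phiS lam D2 * phiS lam D3).
Proof. by apply: eq_bigr => lam _; rewrite !big_cons big_nil mulr1 mulrA. Qed.

Lemma mu_profilesM (g : nat) l i Gs G :
  mu g (profiles Delta (mulcm l (ucm i)) Gs G)
    = \sum_(G' : intpart d) d`!%:R / #|cyc_class G'|%:R
        * mu 0 [:: G'; Delta i; G] * mu g (profiles Delta l Gs G').
Proof.
(* [X lam] collects all factors of the summand that do not involve the last profile. *)
pose X lam := (dimS lam / d`!%:R) ^ (2 - 2 * g%:Z)
  * ((\prod_(j < n) phiS lam (Delta j) ^+ l j) * \prod_(D <- Gs) phiS lam D).
have muX G' : mu g (profiles Delta l Gs G') = \sum_lam X lam * phiS lam G'.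
  by apply: eq_bigr => lam _; rewrite big_profiles /X /= !mulrA.
transitivity (\sum_(lam : SIirr d) X lam * (phiS lam (Delta i) * phiS lam G)).
  apply: eq_bigr => lam _; rewrite /X -mulrA; congr (_ * _).
  by rewrite big_profilesM big_profiles /= mulrCA.
(* Here [nu] comes from the sphere and [lam] from the covering of genus g base. Orthogonality over
   [G'] leaves the diagonal, where (dim/d!)^2 and (d!/dim)^2 cancel. *)
transitivity (\sum_(nu : SIirr d) \sum_(lam : SIirr d)
   X lam * (dimS nu / d`!%:R) ^+ 2 * (phiS nu (Delta i) * phiS nu G)
   * \sum_(G' : intpart d) d`!%:R / #|cyc_class G'|%:R * (phiS nu G' * phiS lam G')).
  apply: eq_bigr => nu _; under eq_bigr => lam _ do rewrite phiS_orthogonality.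
  rewrite (bigD1 nu) //= big1 ?addr0; last first.
    by move=> lam; rewrite eq_sym => /negPf->; rewrite !mulr0.
  have d0 : d`!%:R != 0 :> algC by rewrite pnatr_eq0 -lt0n fact_gt0.
  by have := dimS_neq0 nu => nu0; rewrite eqxx mulr1; field; rewrite d0 nu0.
under [RHS]eq_bigr => G' _ do rewrite mu0_seq3 muX -mulrA mulr_suml mulr_sumr.
rewrite [RHS]exchange_big; apply: eq_bigr => nu _ /=.
under [RHS]eq_bigr => G' _ do rewrite mulrA mulr_sumr.
rewrite [RHS]exchange_big; apply: eq_bigr => lam _ /=.
by rewrite mulr_sumr; apply: eq_bigr => G' _; ring.
Qed.

End Profiles.

(** * Comparison of the coefficients of both sides *)

Section Constants.
Local Open Scope ring_scope.

Lemma zconst_sum (I : finType) (F : I -> algC) :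
  zconst (\sum_i F i) = \sum_i zconst (F i).
Proof. by rewrite /zconst !rmorph_sum. Qed.

Lemma zconstM a b : zconst (a * b) = zconst a * zconst b.
Proof. by rewrite /zconst polyCM rmorphM. Qed.

Lemma zconstMn a n : zconst (a *+ n) = zconst a *+ n.
Proof. by rewrite /zconst polyCMn rmorphMn. Qed.

Lemma zvar_neq0 : zvar != 0.
Proof. by rewrite tofrac_eq0 polyX_eq0. Qed.

End Constants.

(** Only the factor at [i] changes, and (l_i + 1)/(l_i + 1)! = 1/l_i!. *)
Lemma prod_fact_mulcm (n : nat) (l : 'X_{1..n}) (i : 'I_n) :
  ((\prod_(j < n) ((mulcm l (ucm i) j)`!%:R)^-1) *+ (l i).+1
    = \prod_(j < n) ((l j)`!%:R)^-1 :> algC)%R.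
Proof.
rewrite (bigD1 i) //= [RHS](bigD1 i) //= cmM cmU eqxx addn1 factS.
rewrite natrM invfM -2!mulrnAl -mulr_natr mulVf ?pnatr_eq0 // mul1r.
congr (_ * _)%R; apply: eq_bigr => j /negPf ji.
by rewrite cmM cmU eq_sym ji addn0.
Qed.

Lemma sum_mulrn_eq (V : nmodType) (I : finType) (i : I) (F : I -> V) :
  (\sum_j F j *+ (i == j) = F i)%R.
Proof.
rewrite (bigD1 i) //= eqxx big1 ?addr0 // => j.
by rewrite eq_sym => /negPf->.
Qed.

Lemma dpart_sum_pmonom (k d : nat) (D : intpart d) (c : intpart d -> zfield)
    (m : {cmonom (tvar k)}) : (forall r, m (None, r) = 0%N) ->
  (dpart D (\sum_E c E *: (<< m >> * pmonom None E)) = c D *: << m >> :> tpoly k)%R.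
Proof.
move=> m0; rewrite linear_sum -[RHS](sum_mulrn_eq D (fun E => c E *: << m >>)%R).
apply: eq_bigr => E _; rewrite scalerMnr -(dpart_pmonom D E m0).
exact: linearZZ.
Qed.

Section Assembly.
Variables (g d k n : nat) (Delta : 'I_n -> intpart d).
Implicit Types (l : 'X_{1..n}) (Gs : k.-tuple (intpart d)) (G : intpart d).
Local Open Scope ring_scope.

(** The matrix entry of [W D] taking p_G' to p_G. *)
Definition Wcoef (D G G' : intpart d) : zfield :=
  zconst (d`!%:R / #|cyc_class G'|%:R * mu 0 [:: G'; D; G])
    * zvar ^ (d%:Z + (len G')%:Z - (len D)%:Z - (len G)%:Z).

Definition Phicoef l Gs G : zfield :=
  zvar ^ cover_2h2 g (profiles Delta l Gs G)
    * zconst (mu g (profiles Delta l Gs G) * \prod_(j < n) ((l j)`!%:R)^-1).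

(** The differential equation read on the coefficient of one monomial: the factorials, the gluing of
    [mu] and the powers of z are matched separately. *)
Lemma Phicoef_mulcm l i Gs G :
  Phicoef (mulcm l (ucm i)) Gs G *+ (l i).+1
    = \sum_G' Wcoef (Delta i) G G' * Phicoef l Gs G'.
Proof.
rewrite /Phicoef -mulrnAr -zconstMn -mulrnAr prod_fact_mulcm.
rewrite mu_profilesM mulr_suml zconst_sum mulr_sumr; apply: eq_bigr => G' _.
rewrite (cover_2h2_profilesM _ _ _ _ _ _ G') expfzDr ?zvar_neq0 //.
rewrite /Wcoef -[X in zconst X]mulrA zconstM.
by rewrite mulrACA; congr (_ * _); rewrite mulrC.
Qed.

(** This puts the auxiliary variables into the form of constant required by [dpart_pmonom]. *)
Lemma prod_pmonom_SomeE Gs : exists2 m : {cmonom (tvar k)},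
  \prod_(i < k) pmonom (Some i) (tnth Gs i) = << m >> :> tpoly k
  & forall r, m (None, r) = 0%N.
Proof.
exists (\big[mmul/mone]_(i < k) cmonom_seq (Some i) (tnth Gs i)).
  by rewrite -prod_monalgU; apply: eq_bigr => i _; rewrite pmonomE.
move=> r; elim/big_rec: _ => [|i m _ m0]; first by rewrite cm1.
by rewrite cmM m0 cmonom_seqE.
Qed.

Lemma dpart_Phi G' l : dpart G' (Phi g k Delta l)
  = \sum_(Gs : k.-tuple (intpart d))
      Phicoef l Gs G' *: \prod_(i < k) pmonom (Some i) (tnth Gs i).
Proof.
(* With [Gs] fixed, the inner sum over [G] is a combination of the p_G, from which duality extracts
   the term at [G']. *)
rewrite /Phi exchange_big linear_sum; apply: eq_bigr => Gs _ /=.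
have [m -> m0] := prod_pmonom_SomeE Gs.
exact: (dpart_sum_pmonom G' (Phicoef l Gs)).
Qed.

Lemma W_Phi D l : W D (Phi g k Delta l)
  = \sum_G \sum_(Gs : k.-tuple (intpart d))
      (\sum_G' Wcoef D G G' * Phicoef l Gs G')
        *: ((\prod_(i < k) pmonom (Some i) (tnth Gs i)) * pmonom None G).
Proof.
apply: eq_bigr => G _.
pose P (Gs : k.-tuple (intpart d)) : tpoly k :=
  \prod_(i < k) pmonom (Some i) (tnth Gs i).
transitivity (\sum_G' \sum_Gs
    (Wcoef D G G' * Phicoef l Gs G') *: (P Gs * pmonom None G)).
  apply: eq_bigr => G' _; rewrite -/(Wcoef D G G') dpart_Phi mulr_sumr scaler_sumr.
  apply: eq_bigr => Gs _; rewrite -scalerAr scalerA -/(P Gs).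
  by rewrite [pmonom _ _ * _]mulrC.
by rewrite exchange_big; apply: eq_bigr => Gs _; rewrite scaler_suml.
Qed.

End Assembly.

Theorem theoremB (g d k n : nat) (hd : (0 < d)%N) (hn : (0 < n)%N)
    (Delta : 'I_n -> intpart d) (i : 'I_n) :
  fps_deriv i (Phi g k Delta) =1 fps_map (W (Delta i)) (Phi g k Delta).
Proof.
move=> l; rewrite /fps_deriv /fps_map W_Phi /Phi -sumrMnl.
apply: eq_bigr => G _; rewrite -sumrMnl; apply: eq_bigr => Gs _.
by rewrite -Phicoef_mulcm scalerMnl.
Qed.
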